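(* Let $$\varphi_{10}^{\pm}(x,y)=x^{10}-(45\pm18\sqrt5)x^8y^2+(378\pm168\sqrt5)x^6y^4-\left(714\pm\tfrac{1596}{5}\sqrt5\right)x^4y^6+\left(\tfrac{1449}{5}\pm\tfrac{648}{5}\sqrt5\right)x^2y^8-\left(\tfrac{61}{5}\pm\tfrac{682}{125}\sqrt5\right)y^{10},$$ regarded as formal weight enumerators for $q=2\pm\frac{2\sqrt5}{5}$ (corresponding signs). Then: (i) The extremal formal weight enumerator $\varphi_{10}^{+}(x,y)$ (with $q=2+\frac{2\sqrt5}{5}$) does not satisfy the Riemann hypothesis. (ii) The extremal formal weight enumerator $\varphi_{10}^{-}(x,y)$ (with $q=2-\frac{2\sqrt5}{5}$) satisfies the Riemann hypothesis.
   Context: For a matrix $\sigma=\begin{pmatrix} a&b\\ c&e\end{pmatrix}$ and $f\in\mathbf{C}[x,y]$ put $f^\sigma(x,y)=f(ax+by,cx+ey)$; for real $q>0$, $q\ne1$, let $\sigma_q=\frac{1}{\sqrt q}\begin{pmatrix}1&q-1\\1&-1\end{pmatrix}$. A formal weight enumerator for $q$ is a homogeneous polynomial $W(x,y)=x^n+\sum_{i=d}^nA_ix^{n-i}y^i\in\mathbf{C}[x,y]$ with $A_d\ne0$ and $W^{\sigma_q}=-W$. It is divisible by $c\in\mathbf{N}$ if $A_i\neq0$ implies $c\mid i$. For fixed $q,c,n$, a formal weight enumerator for $q$ of degree $n$ divisible by $c$ is called extremal if its $d$ is maximal among all formal weight enumerators for $q$ of degree $n$ divisible by $c$. Here $c=2$,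 $n=10$, and $\varphi_{10}^\pm$ (which have $d=2$) are extremal formal weight enumerators for $q=2\pm\frac{2\sqrt5}{5}$. Zeta polynomial: for $W(x,y)=x^n+\sum_{i=d}^nA_ix^{n-i}y^i$ with $A_d\ne0$ (here $d\ge2$) and real $q>0$, $q\neq1$, the zeta polynomial of $W$ is the unique $P(T)\in\mathbf{C}[T]$ of degree at most $n-d$ such that, expanding in powers of $T$, the coefficient of $T^{n-d}$ in $$\frac{P(T)}{(1-T)(1-qT)}\,(y(1-T)+xT)^n$$ equals $\dfrac{W(x,y)-x^n}{q-1}$. Riemann hypothesis: $W$ with $W^{\sigma_q}=\pm W$ satisfies the Riemann hypothesis if all zeros of its zeta polynomial $P(T)$ in $\mathbf{C}$ have absolute value $1/\sqrt q$. *)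

(* Defs.v *)
(* C is R[i] for R : realType; the variables x, y are 'X_0, 'X_1. *)
From HB Require Import structures.
From mathcomp Require Import all_boot all_order all_algebra.
From mathcomp Require Import mpoly complex reals ring zify.

Set Implicit Arguments.
Unset Strict Implicit.
Unset Printing Implicit Defensive.

Import Order.TTheory GRing.Theory Num.Theory.
Local Open Scope ring_scope.
Local Open Scope complex_scope.

Section Defs.
Variable R : realType.
Local Notation C := R[i].
Implicit Types (W f : {mpoly C[2]}) (s : 'M[C]_2) (q : R) (n d c : nat).

Definition mx_subst s f : {mpoly C[2]} :=
  f \mPo [tuple \sum_(j < 2) s i j *: 'X_j | i < 2].

Definition sigma_q q : 'M[C]_2 :=
  ((Num.sqrt q)^-1)%:C *:
  \matrix_(i < 2, j < 2)
    (if j == 0 then 1 else if i == 0 then (q - 1)%:C else - 1).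

(* A_i, the coefficient of x^(n-i) y^i in a form W of degree n. *)
Definition wcoef n W (i : nat) : C := W@_[multinom [tuple (n - i)%N; i]].

(* The condition 0 < d makes x^n the only term free of y; the second clause
   says that W is a form of degree n with A_0 = 1 and A_i = 0 for 0 < i < d,
   so n and d are determined by W. *)
Definition weight_form n d W : Prop :=
  [/\ (0 < d <= n)%N,
      W = 'X_0 ^+ n
          + \sum_(d <= i < n.+1) wcoef n W i *: ('X_0 ^+ (n - i) * 'X_1 ^+ i)
    & wcoef n W d != 0].

Definition formal_weight_enumerator q n d W : Prop :=
  [/\ 0 < q, q != 1, weight_form n d W & mx_subst (sigma_q q) W = - W].

Definition divisible_by c n W : Prop :=
  forall i, (i <= n)%N -> wcoef n W i != 0 -> (c %| i)%N.

Definition extremal_fwe q c n d W : Prop :=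
  [/\ formal_weight_enumerator q n d W, divisible_by c n W
    & forall d' W', formal_weight_enumerator q n d' W' ->
        divisible_by c n W' -> (d' <= d)%N].

End Defs.

(* Formal power series in T over A are represented by their coefficient
   sequences nat -> A. *)
Definition series_mul (A : nzRingType) (u v : nat -> A) (k : nat) : A :=
  \sum_(i < k.+1) u i * v (k - i)%N.

(* The expansion of 1 / (1 - a T). *)
Definition geom_series (A : nzRingType) (a : A) (k : nat) : A := a ^+ k.

Section Zeta.
Variable R : realType.
Local Notation C := R[i].

(* P(T) (y (1 - T) + x T)^n as a polynomial in T over C[x, y]. *)
Definition zeta_numerator (n : nat) (P : {poly C}) : {poly {mpoly C[2]}} :=
  map_poly (@mpolyC 2 C) P * (('X_1)%:P * (1 - 'X) + ('X_0)%:P * 'X) ^+ n.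

(* The power series P(T) (y (1 - T) + x T)^n / ((1 - T) (1 - q T)) in T. *)
Definition zeta_expansion (q : R) (n : nat) (P : {poly C}) :
    nat -> {mpoly C[2]} :=
  series_mul (series_mul (fun i => (zeta_numerator n P)`_i) (geom_series 1))
             (geom_series (q%:C)%:MP).

(* The zeta polynomial is characterized by this relation; existence and
   uniqueness are zeta_polynomial_exists_unique below. *)
Definition zeta_polynomial (q : R) (n d : nat) (W : {mpoly C[2]})
    (P : {poly C}) : Prop :=
  (size P <= (n - d).+1)%N /\
  zeta_expansion q n P (n - d) = ((q - 1)%:C)^-1 *: (W - 'X_0 ^+ n).


Lemma series_mul_poly (A : nzRingType) (F : {poly A}) (v : nat -> A) N k :
  (k < N)%N ->
  series_mul (fun i => F`_i) v k = (F * \poly_(i < N) v i)`_k.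
Proof.
move=> kN; rewrite coefM; apply: eq_bigr => i _.
by rewrite coef_poly (leq_ltn_trans (leq_subr _ _) kN).
Qed.

Lemma eq_series_mull (A : nzRingType) (u u' v : nat -> A) k :
  (forall i, (i <= k)%N -> u i = u' i) -> series_mul u v k = series_mul u' v k.
Proof. by move=> uu'; apply: eq_bigr => i _; rewrite uu' // -ltnS. Qed.

Let H (q : R) (m a : nat) : {poly C} :=
  (1 - 'X) ^+ a * (\poly_(i < m.+1) 1 * \poly_(i < m.+1) (q%:C) ^+ i).

Let H0 q m a : (H q m a)`_0 = 1.
Proof.
rewrite /H !coef0M !coef_poly /= expr0 !mulr1 -horner_coef0 horner_exp.
by rewrite !hornerE subr0 expr1n.
Qed.

Let mono (n i : nat) : {mpoly C[2]} := 'X_0 ^+ i * 'X_1 ^+ (n - i).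

Let zeta_expansionE q n P m :
  zeta_expansion q n P m = \sum_(i < n.+1)
    ('C(n, i)%:R * (if (i <= m)%N then (P * H q m (n - i))`_(m - i) else 0))
      *: mono n i.
Proof.
rewrite /zeta_expansion.
set F := zeta_numerator n P.
rewrite (eq_series_mull (u' := fun i => (F * \poly_(j < m.+1) 1)`_i)); last first.
  move=> i im; rewrite (@series_mul_poly _ F _ m.+1) //.
  suff -> : \poly_(j < m.+1) geom_series (1 : {mpoly C[2]}) j =
            \poly_(j < m.+1) 1 by [].
  by apply/polyP => j; rewrite !coef_poly /geom_series expr1n.
rewrite (@series_mul_poly _ _ _ m.+1) // /F /zeta_numerator exprDn.
rewrite !big_distrr /= !mulr_suml coef_sum; apply: eq_bigr => i _.
have -> : \poly_(j < m.+1) (1 : {mpoly C[2]}) =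
          map_poly (@mpolyC 2 C) (\poly_(j < m.+1) 1).
  by apply/polyP => j; rewrite coef_map !coef_poly /=; case: ifP.
have -> : \poly_(j < m.+1) geom_series (q%:C)%:MP j =
          map_poly (@mpolyC 2 C) (\poly_(j < m.+1) (q%:C) ^+ j).
  apply/polyP => j; rewrite coef_map !coef_poly /geom_series /=.
  by case: ifP => _; rewrite ?rmorphXn ?rmorph0.
have h1 : (1 - 'X : {poly {mpoly C[2]}}) = map_poly (@mpolyC 2 C) (1 - 'X).
  by rewrite rmorphB /= rmorph1 map_polyX.
rewrite h1 !exprMn -!rmorphXn /=.
set M := map_poly _.
transitivity ((((mono n i)%:P *
   ('X^i * M (P * H q m (n - i)))) *+ 'C(n, i))`_m).
  have MM a b : M (a * b) = M a * M b by rewrite /M rmorphM.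
  have E (A : comNzRingType) (p1 p2 p3 p4 p5 p6 p7 : A) k :
    p1 * (p2 * p3 * (p4 * p5) *+ k) * p6 * p7 =
    (p4 * p2 * (p5 * (p1 * (p3 * (p6 * p7))))) *+ k.
    by rewrite mulrnAr !mulrnAl; congr (_ *+ _); ring.
  by rewrite /H /mono !MM polyCM; congr ((polyseq _)`__); exact: E.
rewrite coefMn coefCM coefXnM; case: (leqP i m) => im.
    rewrite /M coef_map /= mulrC mul_mpolyC -scaler_nat scalerA.
    by rewrite -mulr_natl; congr (_ *: _); rewrite ?mulr_natl.
by rewrite mulr0 mul0rn mulr0 scale0r.
Qed.

Let triangular_exists (h : nat -> {poly C}) (b : nat -> C) N :
  (forall j, (h j)`_0 = 1) ->
  exists P : {poly C},
    (size P <= N)%N /\ forall j, (j < N)%N -> (P * h j)`_j = b j.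
Proof.
move=> h0; elim: N => [|N [P [sP hP]]]; first by exists 0; rewrite size_poly0.
exists (P + (b N - (P * h N)`_N) *: 'X^N); split.
  rewrite (leq_trans (size_polyD _ _)) // geq_max (leq_trans sP) //.
  by rewrite (leq_trans (size_scale_leq _ _)) // size_polyXn.
move=> j; rewrite mulrDl coefD -scalerAl coefZ coefXnM ltnS leq_eqVlt.
case/predU1P => [->|jN]; first by rewrite ltnn subnn h0 mulr1 addrC subrK.
by rewrite jN mulr0 addr0 hP.
Qed.

Let triangular_unique (h : nat -> {poly C}) N (P P' : {poly C}) :
  (forall j, (h j)`_0 = 1) -> (size P <= N)%N -> (size P' <= N)%N ->
  (forall j, (j < N)%N -> (P * h j)`_j = (P' * h j)`_j) -> P = P'.
Proof.
move=> h0 sP sP' PP'; apply/polyP => j; have [jN|Nj] := ltnP j N; last first.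
  by rewrite !nth_default // (leq_trans _ Nj).
elim/ltn_ind: j jN => j IH jN.
have := PP' j jN; rewrite !coefM !big_ord_recr /= subnn h0 !mulr1.
rewrite (eq_bigr (fun i : 'I_j => P'`_i * (h j)`_(j - i))); first by move/addrI.
by move=> i _; rewrite IH // (ltn_trans _ jN).
Qed.

Let mono_coef n (a b : nat -> C) :
  \sum_(i < n.+1) a i *: mono n i = \sum_(i < n.+1) b i *: mono n i ->
  forall i, (i <= n)%N -> a i = b i.
Proof.
have E (c : nat -> C) i : (i <= n)%N ->
    (\sum_(k < n.+1) c k *: mono n k)@_[multinom [tuple i; (n - i)%N]] = c i.
  move=> ni; rewrite linear_sum /=.
  have mE k : mono n k = 'X_[[multinom [tuple k; (n - k)%N]]].
    rewrite mpolyXE_id !big_ord_recl big_ord0 mulr1 !multinomE /=.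
    by congr (_ * _); congr (_ ^+ _); congr mpolyX; congr mnm1; apply/val_inj.
  rewrite (bigD1 (Ordinal (ni : (i < n.+1)%N))) //= big1 => [|k ki].
    by rewrite addr0 mcoeffZ mE mcoeffX (eqxx (_ : multinom _)) mulr1.
  rewrite mcoeffZ mE mcoeffX; case: eqP => [/mnmP/(_ ord0)|]; last first.
    by rewrite mulr0.
  by rewrite !multinomE => ki'; case/eqP: ki; apply/val_inj.
by move=> ab i ni; rewrite -(E a) // ab E.
Qed.

Lemma zeta_polynomial_exists_unique q n d W :
  q != 1 -> weight_form n d W -> exists! P, zeta_polynomial q n d W P.
Proof.
move=> q1 [/andP[d0 dn] WE _].
set m := (n - d)%N; pose h j := H q m (d + j).
have h0 j : (h j)`_0 = 1 by exact: H0.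
pose w i := ((q - 1)%:C)^-1 * (if (i <= m)%N then wcoef n W (n - i) else 0).
have WE' : ((q - 1)%:C)^-1 *: (W - 'X_0 ^+ n) = \sum_(i < n.+1) w i *: mono n i.
  rewrite {1}WE [X in _ *: X]addrC addKr scaler_sumr.
  rewrite big_geq_mkord (reindex_inj rev_ord_inj) /= big_mkcond /=.
  apply: eq_bigr => i _; have ni : (i <= n)%N by rewrite -ltnS.
  rewrite subSS /w /mono subKn //.
  have -> : (d <= n - i)%N = (i <= m)%N.
    by rewrite /m leq_subRL // addnC -leq_subRL.
  by case: ifP; rewrite ?mulr0 ?scale0r // scalerA.
pose g (P : {poly C}) i :=
  'C(n, i)%:R * (if (i <= m)%N then (P * H q m (n - i))`_(m - i) else 0).
have zE P : zeta_polynomial q n d W P <->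
    (size P <= m.+1)%N /\ forall j, (j < m.+1)%N ->
    (P * h j)`_j = w (m - j)%N / 'C(n, m - j)%:R.
  have binN0 i : (i <= n)%N -> 'C(n, i)%:R != 0 :> C.
    by move=> ni; rewrite pnatr_eq0 -lt0n bin_gt0.
  have mn : (m <= n)%N by exact: leq_subr.
  have gE j : (j < m.+1)%N -> g P (m - j)%N = 'C(n, m - j)%:R * (P * h j)`_j.
    move=> jm; rewrite /g leq_subr subKn // /h.
    by have -> : (n - (m - j) = d + j)%N by rewrite /m; lia.
  rewrite /zeta_polynomial -/m WE' zeta_expansionE; split=> -[sP e]; split=> //.
    move=> j jm; have jn : (m - j <= n)%N by rewrite (leq_trans (leq_subr _ _)).
    have gw : g P (m - j)%N = w (m - j)%N := @mono_coef n (g P) w e _ jn.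
    by rewrite -gw gE // [RHS]mulrC mulKf // binN0.
  apply: eq_bigr => i _; rewrite -/(g P i); congr (_ *: _).
  have [im|mi] := leqP i m; last first.
    by rewrite /g /w leqNgt mi /= !mulr0.
  have := gE (m - i)%N; rewrite subKn // => -> //; last by rewrite ltnS leq_subr.
  rewrite e ?ltnS ?leq_subr // subKn // mulrC divfK // binN0 //.
  exact: leq_trans mn.
have [P [sP hP]] := triangular_exists (fun j => w (m - j)%N / 'C(n, m - j)%:R)
                                      m.+1 h0.
exists P; split; first by apply/zE.
move=> P' /zE [sP' hP']; apply: (triangular_unique h0 sP sP') => j jm.
by rewrite hP // hP'.
Qed.

(* Meant for W with W^sigma_q = W or - W. *)
Definition riemann_hypothesis (q : R) (n d : nat) (W : {mpoly C[2]}) : Prop :=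
  exists2 P : {poly C}, zeta_polynomial q n d W P &
    forall z : C, root P z -> `|z| = ((Num.sqrt q)^-1)%:C.

End Zeta.

Section Phi.
Variable R : realType.
Local Notation C := R[i].

(* e = 1 and e = -1 give the upper and the lower signs. *)
Definition q10 (e : R) : R := 2 + e * (2 * Num.sqrt 5 / 5).

Definition phi10 (e : R) : {mpoly C[2]} :=
  let x : {mpoly C[2]} := 'X_0 in
  let y : {mpoly C[2]} := 'X_1 in
  let s : R := e * Num.sqrt 5 in
  x ^+ 10
  - (45 + 18 * s)%:C *: (x ^+ 8 * y ^+ 2)
  + (378 + 168 * s)%:C *: (x ^+ 6 * y ^+ 4)
  - (714 + 1596 / 5 * s)%:C *: (x ^+ 4 * y ^+ 6)
  + (1449 / 5 + 648 / 5 * s)%:C *: (x ^+ 2 * y ^+ 8)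
  - (61 / 5 + 682 / 125 * s)%:C *: y ^+ 10.

End Phi.

(* Main.v *)
(** Write s = e sqrt 5, q = 2 + 2 s / 5 and w ^ 2 = 1 - q.  Then
    2 phi10 = (x + w y)^10 + (x - w y)^10, and sigma_q maps x + w y to
    omega (x - w y) with omega = (1 + w) / sqrt q and omega^10 = -1, so that
    phi10 is anti-invariant.  If W is another even formal weight enumerator of
    degree 10, then W - phi10 vanishes at (1, 0), hence on the orbit of (1, 0)
    under the dihedral group generated by sigma_q and y |-> - y; this orbit
    meets ten lines through the origin.  The degree 10 forms vanishing on these
    lines are odd in y, so W = phi10.

    The zeta polynomial of phi10 is
    P(T) = c (1 - q T^2) T^3 g(T + 1 / (q T)) for an explicit cubic g.  For
    s = - sqrt 5, g has three real roots in ]-3/2, 1[, which lies inside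
    ]-2 / sqrt q, 2 / sqrt q[, so all zeros of P have modulus 1 / sqrt q.  For
    s = sqrt 5, P changes sign on [4/5, 1], to the right of 1 / sqrt q. *)
Require Import Defs.
From mathcomp Require Import all_boot all_order all_algebra.
From mathcomp Require Import mpoly complex reals polyrcf.
From mathcomp Require Import ring lra zify.
Import Order.TTheory GRing.Theory Num.Theory.
Local Open Scope ring_scope.

Set Implicit Arguments.
Unset Strict Implicit.
Unset Printing Implicit Defensive.

(** * Binary forms as coefficient sequences *)

Section BinaryForms.
Variable R : realType.
Local Notation C := R[i].
Implicit Types (a b : nat -> C) (W f : {mpoly C[2]}).

Definition bform n a : {mpoly C[2]} :=
  \sum_(i < n.+1) a i *: ('X_0 ^+ (n - i) * 'X_1 ^+ i).

Lemma eq_bform n a b :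
  (forall i, (i <= n)%N -> a i = b i) -> bform n a = bform n b.
Proof. by move=> ab; apply: eq_bigr => i _; rewrite ab // -ltnS. Qed.

Lemma bformB n a b : bform n a - bform n b = bform n (fun i => a i - b i).
Proof. by rewrite -sumrB; apply: eq_bigr => i _; rewrite scalerBl. Qed.

Lemma bformZ n c (a : nat -> C) : c *: bform n a = bform n (fun i => c * a i).
Proof.
by rewrite /bform scaler_sumr; apply: eq_bigr => i _; rewrite scalerA.
Qed.

Lemma X0_bform n : 'X_0 ^+ n = bform n (fun i => (i == 0)%:R) :> {mpoly C[2]}.
Proof.
rewrite /bform big_ord_recl subn0 expr0 mulr1 scale1r big1 ?addr0 // => i _.
by rewrite scale0r.
Qed.

Lemma bform_lincomb n m (c : nat -> C) (p : nat -> nat) (a : nat -> nat -> C) :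
  \sum_(k < m) c k *: (bform n (a k) *+ p k) =
  bform n (fun j => \sum_(k < m) c k * (a k j *+ p k)).
Proof.
rewrite /bform; under eq_bigr do rewrite -sumrMnl scaler_sumr.
rewrite exchange_big /=; apply: eq_bigr => j _.
rewrite scaler_suml; apply: eq_bigr => k _.
by rewrite -scaler_nat !scalerA -mulrA mulr_natl.
Qed.

(** Binomial expansion of (x - y)^k. For [n - j > k] the truncated exponent [k - (n - j)] is
    harmless, because the binomial coefficient vanishes. *)
Lemma shifted_power_bform n k : (k <= n)%N ->
  ('X_0 - 'X_1) ^+ k * 'X_1 ^+ (n - k) =
  bform n (fun j => (- 1) ^+ (k - (n - j)) * 'C(k, n - j)%:R) :> {mpoly C[2]}.
Proof.
move=> kn; rewrite addrC exprDn mulr_suml.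
rewrite (big_ord_widen n.+1 (fun i =>
  (- 'X_1) ^+ (k - i) * 'X_0 ^+ i *+ 'C(k, i) * 'X_1 ^+ (n - k))) //.
rewrite big_mkcond /bform [RHS](reindex_inj rev_ord_inj) /=.
apply: eq_bigr => i _.
have ni : (i <= n)%N by rewrite -ltnS.
rewrite subSS subKn //; have [ki|ki] := ltnP i k.+1; last first.
  by rewrite bin_small // mulr0 scale0r.
have -> : (n - i = k - i + (n - k))%N by lia.
rewrite -mul_mpolyC rmorphM rmorphXn rmorphN1 rmorph_nat.
by rewrite (exprNn ('X_1 : {mpoly C[2]})) exprD; ring.
Qed.

Lemma wcoef_bform n a i : (i <= n)%N -> wcoef n (bform n a) i = a i.
Proof.
move=> ni; rewrite /wcoef linear_sum /=.
have mE k : 'X_0 ^+ (n - k) * 'X_1 ^+ k =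
    'X_[[multinom [tuple (n - k)%N; k]]] :> {mpoly C[2]}.
  rewrite [RHS]mpolyXE_id !big_ord_recl big_ord0 mulr1 !multinomE /=.
  by congr (_ * _); congr (_ ^+ _); congr mpolyX; congr mnm1; apply/val_inj.
rewrite (bigD1 (Ordinal (ni : (i < n.+1)%N))) //= big1 => [|k ki].
  by rewrite addr0 mcoeffZ mE mcoeffX (eqxx (_ : multinom _)) mulr1.
rewrite mcoeffZ mE mcoeffX; case: eqP => [/mnmP/(_ (lift ord0 ord0))|].
  by rewrite !multinomE /= => ik; case/eqP: ki; apply/val_inj.
by rewrite mulr0.
Qed.

(** Trades the sum starting at [d] for a full coefficient sequence, so that two forms can be
    subtracted coefficientwise. *)
Lemma weight_formP n d W :
  weight_form n d W <->
  exists a, [/\ W = bform n a, (0 < d <= n)%N, a 0 = 1,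
    (forall i, (0 < i < d)%N -> a i = 0) & a d != 0].
Proof.
split=> [[dn WE Wd]|[a [-> dn a0 ai ad]]].
  exists (fun i => if i == 0 then 1 else if (i < d)%N then 0 else wcoef n W i).
  case/andP: (dn) => d0 _; split=> //.
  - rewrite {1}WE /bform big_ord_recl subn0 /= expr0 mulr1 scale1r.
    congr (_ + _); rewrite big_geq_mkord big_mkcond big_ord_recl /=.
    rewrite leqNgt d0 add0r; apply: eq_bigr => i _ /=.
    by rewrite ltnNge; case: ifP; rewrite ?scale0r.
  - by move=> [|i] //= ->.
  - by move: d0 Wd; rewrite ltnn; case: (d).
case/andP: (dn) => d0 dn'; split=> //; last by rewrite wcoef_bform.
rewrite {1}/bform big_ord_recl subn0 /= a0 expr0 mulr1 scale1r.
congr (_ + _); rewrite big_geq_mkord [RHS]big_mkcond [RHS]big_ord_recl /=.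
rewrite leqNgt d0 add0r; apply: eq_bigr => i _ /=.
case: leqP => [_|id]; first by rewrite wcoef_bform.
by rewrite ai ?scale0r.
Qed.

Lemma meval_bform n a (v : 'I_2 -> C) :
  (bform n a).@[v] = \sum_(i < n.+1) a i * (v 0 ^+ (n - i) * v 1 ^+ i).
Proof.
rewrite raddf_sum; apply: eq_bigr => i _ /=.
by rewrite mevalZ mevalM !rmorphXn /= !mevalXU.
Qed.

Lemma meval_mx_subst (s : 'M[C]_2) f (v : 'I_2 -> C) :
  (mx_subst s f).@[v] = f.@[fun i => \sum_j s i j * v j].
Proof.
rewrite /mx_subst comp_mpoly_meval; apply: meval_eq => i; rewrite tnth_mktuple.
by rewrite raddf_sum; apply: eq_bigr => j _ /=; rewrite mevalZ mevalXU.
Qed.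

End BinaryForms.

(** * The zeta relation in powers of x - y *)

Section ZetaSeries.
Variable R : realType.
Local Notation C := R[i].

(** The series P(T) / ((1 - T)(1 - q T)) over C, free of x and y. *)
Definition zeta_series (q : R) (P : {poly C}) : nat -> C :=
  series_mul (series_mul (fun i => P`_i) (geom_series 1)) (geom_series q%:C%C).

(** Terms of degree [N] or more cannot reach the coefficient [k]; after truncation the laws of
    polynomial rings apply. *)
Lemma series_mul2_poly (A : nzRingType) (F : {poly A}) (u v : nat -> A) N k :
  (k < N)%N ->
  series_mul (series_mul (fun i => F`_i) u) v k =
  (F * \poly_(i < N) u i * \poly_(i < N) v i)`_k.
Proof.
move=> kN; rewrite -series_mul_poly //; apply: eq_series_mull => i ik.
by rewrite (series_mul_poly _ _ (leq_ltn_trans ik kN)).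
Qed.

(** Since y (1 - T) + x T = y + (x - y) T, the variables enter only through the coefficients of the
    n-th power of this linear polynomial in T. *)
Lemma zeta_expansion_series (q : R) n (P : {poly C}) m : (m <= n)%N ->
  zeta_expansion q n P m = \sum_(k < m.+1)
    zeta_series q P (m - k) *:
      (('X_0 - 'X_1) ^+ k * 'X_1 ^+ (n - k) *+ 'C(n, k)).
Proof.
move=> mn; rewrite /zeta_expansion (series_mul2_poly _ _ _ (ltnSn m)).
rewrite /zeta_numerator.
have -> : ('X_1)%:P * (1 - 'X) + ('X_0)%:P * 'X =
    ('X_1)%:P + ('X_0 - 'X_1)%:P * 'X :> {poly {mpoly C[2]}}.
  by rewrite polyCB; ring.
rewrite (mulrC (map_poly _ P)) -!mulrA coefM; apply: eq_bigr => k _.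
have km : (k <= m)%N by rewrite -ltnS.
have -> : (((('X_1)%:P + ('X_0 - 'X_1)%:P * 'X) ^+ n)`_k : {mpoly C[2]}) =
    ('X_0 - 'X_1) ^+ k * 'X_1 ^+ (n - k) *+ 'C(n, k).
  rewrite exprDn coef_sum (bigD1 (Ordinal (leq_trans km mn : k < n.+1)%N)) //=.
  rewrite exprMn -!rmorphXn coefMn mulrA -rmorphM coefCM coefXn eqxx mulr1.
  rewrite mulrC big1 ?addr0 // => j jk.
  rewrite exprMn -!rmorphXn coefMn mulrA -rmorphM coefCM coefXn.
  case: eqP => [kj|]; last by rewrite mulr0 mul0rn.
  by case/eqP: jk; apply/val_inj.
rewrite mulrC -mul_mpolyC; congr (_ * _).
rewrite /zeta_series (@series_mul2_poly _ _ _ _ m.+1) ?ltnS ?leq_subr //.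
rewrite -coef_map !rmorphM /= mulrA.
congr (polyseq (_ * _ * _))`__.
  apply/polyP => i; rewrite coef_map !coef_poly /=.
  by case: ifP; rewrite ?rmorph0 // /geom_series !expr1n.
apply/polyP => i; rewrite coef_map !coef_poly /=.
by case: ifP; rewrite ?rmorph0 // /geom_series rmorphXn.
Qed.

End ZetaSeries.

(** * Anti-invariance of phi10 *)

Section Phi10Coefficients.
Variables (F : numFieldType) (s : F).
Hypothesis s2 : s ^+ 2 = 5.
Implicit Types (w : F) (i : nat).

(* Both signs are treated at once: q10_of (e * Num.sqrt 5) is q10 e. *)
Definition q10_of : F := 2 + 2 / 5 * s.

Definition phi10_coef i : F :=
  nth 0 [:: 1; 0; - (45 + 18 * s); 0; 378 + 168 * s; 0;
            - (714 + 1596 / 5 * s); 0; 1449 / 5 + 648 / 5 * s; 0;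
            - (61 / 5 + 682 / 125 * s)] i.

(** In (x + w y)^10 + (x - w y)^10 only even powers of [w] survive; they are powers of 1 - q, hence
    polynomials in [s]. *)
Lemma phi10_coef_binomial w i : w ^+ 2 = 1 - q10_of -> (i <= 10)%N ->
  phi10_coef i = (~~ odd i)%:R * 'C(10, i)%:R * w ^+ i.
Proof.
rewrite /phi10_coef /q10_of => w2.
have E k : w ^+ k.*2 = (w ^+ 2) ^+ k by rewrite -mul2n exprM.
move: i; do 11?[case=> [_|] /=; rewrite ?mul0r ?mul1r //].
- by rewrite (E 1%N) w2 (_ : 'C(10, 2) = 45%N) //; field: s2.
- by rewrite (E 2%N) w2 (_ : 'C(10, 4) = 210%N) //; field: s2.
- by rewrite (E 3%N) w2 (_ : 'C(10, 6) = 210%N) //; field: s2.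
- by rewrite (E 4%N) w2 (_ : 'C(10, 8) = 45%N) //; field: s2.
- by rewrite (E 5%N) w2; field: s2.
Qed.

(** As q = (1 + w)(1 - w), the sum (1 + w)^10 + q^5 has the factor (1 + w)^5 + (1 - w)^5 = 2 (1 + 10
    w^2 + 5 w^4), and w^2 = -1 - 2 s / 5 is a root of 1 + 10 t + 5 t^2. *)
Lemma rotation_pow10 w : w ^+ 2 = 1 - q10_of -> (1 + w) ^+ 10 = - q10_of ^+ 5.
Proof.
move=> w2; have qE : q10_of = (1 + w) * (1 - w) by rewrite -[LHS]subr0; ring: w2.
have zero : (1 + w) ^+ 5 + (1 - w) ^+ 5 = 0.
  have -> : (1 + w) ^+ 5 + (1 - w) ^+ 5 =
      2 * (1 + 10 * w ^+ 2 + 5 * (w ^+ 2) ^+ 2) by ring.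
  by rewrite w2 /q10_of; field: s2.
apply/eqP; rewrite -subr_eq0 opprK qE exprMn (exprD _ 5 5) -mulrDr zero.
by rewrite mulr0.
Qed.
End Phi10Coefficients.

Lemma real_complex_sqr_nat (R : realType) (s : R) (n : nat) :
  s ^+ 2 = n%:R -> s%:C%C ^+ 2 = n%:R.
Proof. by move=> s2; rewrite -rmorphXn s2 rmorph_nat. Qed.

Section Phi10Forms.
Variable R : realType.
Local Notation C := R[i].
Local Notation X := ('X_0 : {mpoly C[2]}).
Local Notation Y := ('X_1 : {mpoly C[2]}).
Local Open Scope complex_scope.

Variable s : R.
Hypothesis s2 : s ^+ 2 = 5.

Let sC2 : s%:C ^+ 2 = 5.
Proof. exact: real_complex_sqr_nat. Qed.

Lemma q10_ofC : (q10_of s)%:C = q10_of s%:C.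
Proof. by rewrite /q10_of rmorphD rmorphM fmorph_div !rmorph_nat. Qed.

Definition line_pow10 (w : C) : {mpoly C[2]} := (X + w *: Y) ^+ 10.

Lemma phi10_two_powers (w : C) : w ^+ 2 = 1 - q10_of s%:C ->
  bform 10 (phi10_coef s%:C) *+ 2 = line_pow10 w + line_pow10 (- w).
Proof.
move=> w2.
rewrite (eq_bform (fun i => phi10_coef_binomial sC2 w2 (i := i))).
rewrite /line_pow10 !exprDn -big_split -sumrMnl; apply: eq_bigr => i _ /=.
rewrite !exprZn -!scalerAr exprNn -mulrnDl -scalerDl.
rewrite -scaler_nat -[in RHS]scaler_nat !scalerA.
congr (_ *: _); rewrite -signr_odd.
by case: (odd i) => /=; ring.
Qed.

Lemma mpoly_mulr2n_inj (f g : {mpoly C[2]}) : f *+ 2 = g *+ 2 -> f = g.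
Proof.
move=> fg; apply/mpolyP => m; apply/eqP; have := congr1 (mcoeff m) fg.
by rewrite !mcoeffMn => /eqP; rewrite eqr_pMn2r.
Qed.

Lemma mx_substD (t : 'M[C]_2) f g :
  mx_subst t (f + g) = mx_subst t f + mx_subst t g.
Proof. exact: linearD. Qed.

Lemma phi10_antiinvariant : 0 < q10_of s ->
  mx_subst (sigma_q (q10_of s)) (bform 10 (phi10_coef s%:C)) =
  - bform 10 (phi10_coef s%:C).
Proof.
move=> q0; have [w w2] : exists w : C, w ^+ 2 = 1 - q10_of s%:C.
  by exists (sqrtC (1 - q10_of s%:C)); exact: sqrtCK.
apply: mpoly_mulr2n_inj.
rewrite mulNrn [in LHS]mulr2n -mx_substD -mulr2n (phi10_two_powers w2).
set r : C := ((Num.sqrt (q10_of s))^-1)%:C.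
have rq : r ^+ 2 * q10_of s%:C = 1.
  by rewrite /r -rmorphXn exprVn sqr_sqrtr ?ltW // -q10_ofC -rmorphM mulVf ?gt_eqF.
have XE : mx_subst (sigma_q (q10_of s)) X = r *: (X + (q10_of s%:C - 1) *: Y).
  rewrite /mx_subst comp_mpolyXU nth_mktuple.
  rewrite !big_ord_recl big_ord0 addr0 !mxE /= mulr1 scalerDr scalerA.
  rewrite -q10_ofC -[1 in RHS](rmorph1 (real_complex R)) -rmorphB /=.
  by congr (_ *: mpolyX _ _ + _ *: mpolyX _ _); congr mnm1; apply/val_inj.
have YE : mx_subst (sigma_q (q10_of s)) Y = r *: (X - Y).
  rewrite /mx_subst comp_mpolyXU nth_mktuple.
  rewrite !big_ord_recl big_ord0 addr0 !mxE /= mulr1 mulrN1 scaleNr scalerBr.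
  by congr (_ *: mpolyX _ _ - _ *: mpolyX _ _); congr mnm1; apply/val_inj.
(* Each tenth power goes to minus the other one: the coefficients of [Y] match because v^2 = 1 - q.
   This is applied to [w] and to [- w]. *)
have lin (v : C) : v ^+ 2 = w ^+ 2 ->
    mx_subst (sigma_q (q10_of s)) (line_pow10 v) = - line_pow10 (- v).
  move=> v2; rewrite /line_pow10 scaleNr /mx_subst rmorphXn rmorphD /=.
  rewrite linearZ /= -!/(mx_subst _ _) XE YE.
  have -> : r *: (X + (q10_of s%:C - 1) *: Y) + v *: (r *: (X - Y)) =
     (r * (1 + v)) *: (X - v *: Y).
    rewrite !scalerBr !scalerDr !scalerA addrACA -scalerDl -scalerBl -scaleNr.
    congr (_ *: _ + _ *: _); first by ring.
    apply/eqP; rewrite -subr_eq0 (_ : _ - _ = r * (v ^+ 2 + q10_of s%:C - 1)).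
      by rewrite v2 w2 addrNK subrr mulr0.
    by ring.
  rewrite exprZn exprMn.
  have -> : (1 + v) ^+ 10 = - q10_of s%:C ^+ 5.
    by apply: (rotation_pow10 sC2); rewrite v2.
  by rewrite (exprM _ 2 5) mulrN -exprMn rq expr1n scaleN1r.
have := lin _ (sqrrN w); rewrite (opprK w); have := lin w erefl.
move: (line_pow10 w) (line_pow10 (- w)) => f g fg gf.
by rewrite mx_substD fg gf -opprD addrC.
Qed.
End Phi10Forms.

(** * Extremality of phi10 *)

Section BinaryFormValues.
Variable R : realType.
Local Notation C := R[i].
Implicit Types (b : nat -> C) (u v c : C).

Definition bval n b u v : C := \sum_(i < n.+1) b i * (u ^+ (n - i) * v ^+ i).

Lemma bvalZ n b c u v : bval n b (c * u) (c * v) = c ^+ n * bval n b u v.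
Proof.
rewrite /bval mulr_sumr; apply: eq_bigr => i _; rewrite !exprMn.
have -> : c ^+ n = c ^+ (n - i) * c ^+ i by rewrite -exprD subnK // -ltnS.
by ring.
Qed.

Lemma bval_even n b u v : (forall i, (i <= n)%N -> odd i -> b i = 0) ->
  bval n b u (- v) = bval n b u v.
Proof.
move=> b_odd; apply: eq_bigr => i _; rewrite exprNn -signr_odd.
have [oi|_] := boolP (odd i); last by rewrite expr0 mul1r.
by rewrite (b_odd i _ oi) ?mul0r // -ltnS.
Qed.

(** A zero of the form is carried by sigma_q to a zero; by homogeneity the nonzero scalar 1 / sqrt q
    factors out and is dropped. *)
Lemma antiinvariant_root (q : R) n b u v : 0 < q ->
  mx_subst (sigma_q q) (bform n b) = - bform n b ->
  bval n b u v = 0 -> bval n b (u + (q - 1)%:C%C * v) (u - v) = 0.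
Proof.
move=> q0 bq uv0; pose p (i : 'I_2) := if i == 0 then u else v.
have /(congr1 (fun f => f.@[p])) := bq.
rewrite meval_mx_subst mevalN !meval_bform -!/(bval _ _ _ _).
rewrite !big_ord_recl !big_ord0 !mxE /= /p /= uv0 oppr0 !addr0 !mulr1.
rewrite -!mulrA -!mulrDr mulN1r bvalZ => /eqP; rewrite mulf_eq0 => /orP[|/eqP //].
by rewrite expf_eq0 fmorph_eq0 invr_eq0 sqrtr_eq0 leNgt q0 andbF.
Qed.

End BinaryFormValues.

Section Extremal.
Variable R : realType.
Local Notation C := R[i].
Local Open Scope complex_scope.

Variable s : R.
Hypothesis s2 : s ^+ 2 = 5.
Let q := q10_of s.
Hypothesis q_gt0 : 0 < q.

(** Refutes linear equations in [s]: each would make [s] a rational number whose square is not 5. *)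
Let s_sqr (t : R) : s = t -> t ^+ 2 = 5.
Proof. by move=> <-. Qed.

Lemma orbit_slopes_uniq : uniq [:: 1; 5; 9 - 4 * s; 45 - 20 * s].
Proof.
rewrite /= !inE !negb_or -!andbA andbT.
repeat (apply/andP; split); apply/eqP => e.
- by lra.
- by have /s_sqr : s = 2 by [lra]; lra.
- by have /s_sqr : s = 11 / 5 by [lra]; lra.
- by have /s_sqr : s = 1 by [lra]; lra.
- by have /s_sqr : s = 2 by [lra]; lra.
- by have /s_sqr : s = 9 / 4 by [lra]; lra.
Qed.

Lemma orbit_neq0 :
  [/\ 2 - 2 / 5 * s != 0, - 8 / 5 * s != 0 & - 16 / 5 - 16 / 5 * s != 0].
Proof.
split; apply/eqP => e.
- by have /s_sqr : s = 5 by [lra]; lra.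
- by have /s_sqr : s = 0 by [lra]; lra.
- by have /s_sqr : s = - 1 by [lra]; lra.
Qed.

(* On the orbit of (1, 0), the squared slopes y^2 / x^2 take the values of
   [orbit_slopes_uniq] besides 0 and infinity; a form x^2 y^2 B(y^2 / x^2)
   with deg B <= 3 cannot vanish at all of them unless B = 0. *)
Lemma antiinvariant_coef2 (b : nat -> C) :
  (forall i, (i <= 10)%N -> odd i -> b i = 0) -> b 0 = 0 ->
  mx_subst (sigma_q q) (bform 10 b) = - bform 10 b -> b 2 = 0.
Proof.
move=> b_odd b0 bq.
have [v3 v4 v5] := orbit_neq0.
pose f (u v : R) := bval 10 b u%:C v%:C.
(* The reflection y |-> - y, harmless since odd coefficients vanish, followed by sigma_q up to a
   scalar; here q - 1 = 1 + 2 s / 5. *)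
have step u v : f u v = 0 -> f (u - (1 + 2 / 5 * s) * v) (u + v) = 0.
  rewrite /f -(bval_even _ _ b_odd) => /(antiinvariant_root q_gt0 bq) <-.
  rewrite -!rmorphN -rmorphM -!rmorphD opprK /q /q10_of.
  by congr (bval _ _ (_ %:C) _); field.
(* Five steps lead from (1, 0) to a point with x = 0; the four points in between have the squared
   slopes listed in [rs] below. *)
have f0 : f 1 0 = 0.
  rewrite /f /bval big_ord_recl b0 mul0r add0r big1 // => i _.
  by rewrite rmorph0 expr0n /= !mulr0.
have f1 : f 1 1 = 0.
  by have := step _ _ f0; rewrite mulr0 subr0 addr0.
have f2 : f (- 2 / 5 * s) 2 = 0 by rewrite -(step _ _ f1); congr f; field.
have f3 : f (- 2 - 6 / 5 * s) (2 - 2 / 5 * s) = 0.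
  by rewrite -(step _ _ f2); congr f; field.
have f4 : f (- 16 / 5 - 8 / 5 * s) (- 8 / 5 * s) = 0.
  by rewrite -(step _ _ f3); congr f; field: s2.
have f5 : f 0 (- 16 / 5 - 16 / 5 * s) = 0.
  by rewrite -(step _ _ f4); congr f; field: s2.
have b10 : b 10 = 0.
  have : f 0 (- 16 / 5 - 16 / 5 * s) = b 10 * (- 16 / 5 - 16 / 5 * s)%:C ^+ 10.
    rewrite /f /bval big_ord_recr /= big1 => [|i _]; first by rewrite mul1r add0r.
    by rewrite rmorph0 expr0n subn_eq0 leqNgt ltnS -ltnS ltn_ord mul0r mulr0.
  rewrite f5 => /esym/eqP; rewrite mulf_eq0 => /orP[/eqP //|].
  by rewrite expf_eq0 fmorph_eq0 (negPf v5).
pose p := Poly [:: b 2; b 4; b 6; b 8].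
(* With [b 0], [b 10] and the odd coefficients zero, the form equals x^8 y^2 p(y^2 / x^2) wherever x
   is nonzero. *)
have f_root u v t : f u v = 0 -> v != 0 -> v ^+ 2 = t * u ^+ 2 -> root p t%:C.
  move=> fuv v0 vu.
  have u0 : u != 0.
    apply: contra_neq v0 => u0; apply/eqP.
    by rewrite -sqrf_eq0 vu u0 expr0n mulr0.
  move/eqP: fuv; rewrite (_ : f u v = (u ^+ 8 * v ^+ 2)%:C * p.[t%:C]).
    by rewrite mulf_eq0 fmorph_eq0 mulf_eq0 !expf_eq0 (negPf u0) (negPf v0).
  rewrite /f /bval horner_Poly !big_ord_recl big_ord0 /= b0 b10.
  have vuC : v%:C ^+ 2 = t%:C * u%:C ^+ 2 by rewrite -!rmorphXn -rmorphM vu.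
  rewrite ?(b_odd 1%N, b_odd 3%N, b_odd 5%N, b_odd 7%N, b_odd 9%N) //.
  rewrite rmorphM !rmorphXn !mul0r.
  by ring: vuC.
pose rs := [:: 1; 5; 9 - 4 * s; 45 - 20 * s].
have rs_root : all (root p) (map (real_complex R) rs).
  rewrite /= andbT; apply/and4P; split.
  - by apply: (f_root _ _ _ f1); rewrite ?oner_eq0 ?mul1r.
  - by apply: (f_root _ _ _ f2); [rewrite pnatr_eq0|field: s2].
  - by apply: (f_root _ _ _ f3) => //; field: s2.
  - by apply: (f_root _ _ _ f4) => //; field: s2.
(* Four distinct roots are too many for a nonzero polynomial of degree at most 3. *)
have p0 : p = 0.
  apply/eqP; apply: contraT => p0.
  have := max_poly_roots p0 rs_root.
  rewrite map_inj_uniq ?orbit_slopes_uniq; last exact: fmorph_inj.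
  by move=> /(_ isT); rewrite ltnNge (leq_trans (size_Poly _)).
by have := coef_Poly [:: b 2; b 4; b 6; b 8] 0; rewrite -/p p0 coef0.
Qed.

Lemma q10_of_neq1 : q != 1.
Proof.
by apply/eqP; rewrite /q /q10_of => e; have /s_sqr : s = - 5 / 2 by [lra]; lra.
Qed.

Lemma phi10_coef2 : phi10_coef s%:C 2 != 0.
Proof.
rewrite (_ : phi10_coef _ _ = (- (45 + 18 * s))%:C); last first.
  by rewrite rmorphN rmorphD rmorphM !rmorph_nat.
rewrite fmorph_eq0; apply/eqP => e.
by have /s_sqr : s = - 5 / 2 by [lra]; lra.
Qed.

Lemma phi10_weight_form : weight_form 10 2 (bform 10 (phi10_coef s%:C)).
Proof.
apply/weight_formP; exists (phi10_coef s%:C); split=> //; last exact: phi10_coef2.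
by case=> [|[|[|i]]].
Qed.

Lemma phi10_extremal :
  extremal_fwe q 2 10 2 (bform 10 (phi10_coef s%:C)).
Proof.
have phi_odd i : (i <= 10)%N -> odd i -> phi10_coef s%:C i = 0.
  by move: i; do 11?[case=> [//|]].
split.
- split=> //; [exact: q10_of_neq1|exact: phi10_weight_form|].
  exact: phi10_antiinvariant.
- move=> i i10; rewrite wcoef_bform // dvdn2; apply: contra => io.
  by rewrite phi_odd.
move=> d' W' [_ _ /weight_formP[a [WE /andP[_ d10] a0 ad _]] Wq] W2.
rewrite leqNgt; apply/negP => d2.
have a_odd i : (i <= 10)%N -> odd i -> a i = 0.
  move=> i10 io; apply/eqP; move: (W2 i i10); rewrite WE wcoef_bform // dvdn2.
  by rewrite io; case: (a i == 0) => // /(_ isT).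
(* The difference W' - phi10 is even, anti-invariant and has no x^10 term, so its y^2 coefficient is
   zero. As d' > 2, that of W' is zero too, which would force the nonzero one of phi10 to vanish. *)
pose b i := a i - phi10_coef s%:C i.
have : b 2 = 0.
  apply: antiinvariant_coef2 => [i i10 io||].
  - by rewrite /b a_odd // phi_odd // subrr.
  - by rewrite /b a0 subrr.
  rewrite -bformB /mx_subst rmorphB /= -!/(mx_subst _ _) -WE Wq.
  by rewrite (phi10_antiinvariant s2 q_gt0) opprB opprK addrC.
apply/eqP; rewrite /b ad ?d2 // sub0r oppr_eq0; exact: phi10_coef2.
Qed.
End Extremal.

(** * The zeta polynomial of phi10 *)

Section ZetaCoefficients.
Variables (F : numFieldType) (s : F).
Hypothesis s2 : s ^+ 2 = 5.

(** Coefficients in increasing powers of T. The field is left general: C serves for the zeta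
    relation, R for the intermediate value theorem. *)
Definition zeta10_coef : seq F :=
  [:: - 1; 2 / 5 * s; 2 + 6 / 5 * s; 16 / 5 + 8 / 5 * s; 0;
      - (48 / 5 + 112 / 25 * s); - (96 / 5 + 224 / 25 * s);
      - (256 / 25 + 128 / 25 * s); 896 / 25 + 384 / 25 * s].

(* The first coefficients of P(T) / ((1 - T) (1 - q T)). *)
Definition zeta10_series : seq F :=
  [:: - 1; - 3; - 5 + 2 / 5 * s; - 5 + 2 * s; - 9 / 5 + 26 / 5 * s;
      7 / 5 + 42 / 5 * s; - 5 + 178 / 25 * s; - (153 / 5 + 78 / 25 * s);
      - (1661 / 25 + 462 / 25 * s)].

(** Division by 1 - a T is a first-order recurrence, so the series can be checked one coefficient at
    a time. *)
Lemma series_mul_geomS (A : nzRingType) (u : nat -> A) (a : A) k :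
  series_mul u (geom_series a) k.+1 = series_mul u (geom_series a) k * a + u k.+1.
Proof.
rewrite /series_mul big_ord_recr /= subnn /geom_series expr0 mulr1 mulr_suml.
congr (_ + _); apply: eq_bigr => i _.
have ik : (i <= k)%N by rewrite -ltnS.
by rewrite subSn // exprSr mulrA.
Qed.

Lemma zeta10_seriesP k : (k <= 8)%N ->
  series_mul (series_mul (fun i => zeta10_coef`_i) (geom_series 1))
    (geom_series (q10_of s)) k = zeta10_series`_k.
Proof.
have ind (u v : nat -> F) (a : F) : u 0 = v 0 ->
    (forall i, (i < 8)%N -> v i.+1 = v i * a + u i.+1) ->
    forall i, (i <= 8)%N -> series_mul u (geom_series a) i = v i.
  move=> uv0 uvS; elim=> [_|i IH i8].
    by rewrite /series_mul big_ord1 /geom_series expr0 mulr1.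
  by rewrite series_mul_geomS IH ?(ltnW i8) // -uvS.
(* Division by 1 - T yields the partial sums. *)
pose c := fun i => \sum_(j < i.+1) zeta10_coef`_j.
have cE i : (i <= 8)%N ->
    series_mul (fun i => zeta10_coef`_i) (geom_series 1) i = c i.
  apply: ind => [|j _]; first by rewrite /c big_ord1.
  by rewrite /c big_ord_recr /= mulr1.
move=> k8; rewrite (eq_series_mull (u' := c)); last first.
  by move=> i ik; rewrite cE // (leq_trans ik).
apply: (ind _ (fun i => zeta10_series`_i)) k8 => [|j].
  by rewrite /c big_ord1.
do 8?[case: j => [_|j] /=;
  first by rewrite /c !big_ord_recr big_ord0 /= /q10_of; field: s2].
by [].
Qed.

(* Coefficient of x^(10-j) y^j in the relation defining the zeta polynomial,
   once (y (1 - T) + x T)^10 is expanded as (y + (x - y) T)^10. *)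
Lemma zeta10_weights j : (j <= 10)%N ->
  \sum_(k < 9) zeta10_series`_(8 - k)
    * ((- 1) ^+ (k - (10 - j)) * 'C(k, 10 - j)%:R *+ 'C(10, k)) =
  (q10_of s - 1)^-1 * (phi10_coef s j - (j == 0)%:R).
Proof.
(* (1 + 2 s / 5)(5 - 2 s) = 5 - 4 s^2 / 5 = 1. *)
have -> : (q10_of s - 1)^-1 = 5 - 2 * s.
  have qE : (q10_of s - 1) * (5 - 2 * s) = 1 by rewrite /q10_of; field: s2.
  have q0 : q10_of s - 1 != 0.
    by apply/eqP => q0; move/eqP: qE; rewrite q0 mul0r eq_sym oner_eq0.
  by apply: (mulfI q0); rewrite mulfV // qE.
rewrite !big_ord_recr big_ord0.
move: j; do 11?[case=> [_|]].
all: rewrite /phi10_coef /=.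
(* Binomials and exponents become numerals, which leaves identities in [s] modulo s^2 = 5. *)
all: repeat match goal with |- context [binomial ?a ?b] =>
  let v := eval vm_compute in (binomial a b) in change (binomial a b) with v end.
all: repeat match goal with |- context [?x ^+ ?a] =>
  let v := eval vm_compute in a in progress change (x ^+ a) with (x ^+ v) end.
all: try by [].
all: field: s2.
all: by [].
Qed.
End ZetaCoefficients.

Lemma rmorph_zeta10_coef (F F' : numFieldType) (f : {rmorphism F -> F'}) s :
  map f (zeta10_coef s) = zeta10_coef (f s).
Proof.
have D (a b : nat) : f (a%:R / b%:R) = a%:R / b%:R.
  by rewrite fmorph_div !rmorph_nat.
have E (a b : F) : f (a + b * s) = f a + f b * f s by rewrite rmorphD rmorphM.
rewrite /zeta10_coef /=.
congr [:: _; _; _; _; _; _; _; _; _].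
- by rewrite rmorphN1.
- by rewrite rmorphM D.
- by rewrite E D rmorph_nat.
- by rewrite E !D.
- by rewrite rmorph0.
- by rewrite rmorphN E !D.
- by rewrite rmorphN E !D.
- by rewrite rmorphN E !D.
- by rewrite E !D.
Qed.

Lemma big_ord11_even (V : nmodType) (t : nat -> V) :
  (forall i, (i <= 10)%N -> odd i -> t i = 0) ->
  \sum_(i < 11) t i = t 0 + t 2 + t 4 + t 6 + t 8 + t 10.
Proof.
move=> t_odd; rewrite !big_ord_recl big_ord0 /=.
rewrite (t_odd 1) // (t_odd 3) // (t_odd 5) // (t_odd 7) // (t_odd 9) //.
by rewrite !add0r addr0 !addrA.
Qed.

Lemma phi10_bform (R : realType) (e : R) :
  phi10 e = bform 10 (phi10_coef (e * Num.sqrt 5)%:C%C).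
Proof.
have D (a b : nat) : (a%:R / b%:R)%:C%C = a%:R / b%:R :> R[i].
  by rewrite fmorph_div !rmorph_nat.
have E (a b t : R) : (a + b * t)%:C%C = a%:C%C + b%:C%C * t%:C%C :> R[i].
  by rewrite rmorphD rmorphM.
pose t i : {mpoly R[i][2]} :=
  phi10_coef (e * Num.sqrt 5)%:C%C i *: ('X_0 ^+ (10 - i) * 'X_1 ^+ i).
rewrite /bform [RHS](@big_ord11_even _ t) /t; last first.
  by do 11?[case=> [//|]] => // *; rewrite scale0r.
rewrite /phi10; cbv zeta.
have eqD (f g f' g' : {mpoly R[i][2]}) : f = f' -> g = g' -> f + g = f' + g'.
  by move=> -> ->.
apply: (eqD); [apply: (eqD); [apply: (eqD); [apply: (eqD); [apply: (eqD)|]|]|]|].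
- by rewrite expr0 mulr1 scale1r.
- by rewrite /phi10_coef /= scaleNr E !rmorph_nat.
- by rewrite /phi10_coef /= E !rmorph_nat.
- by rewrite /phi10_coef /= scaleNr E D rmorph_nat.
- by rewrite /phi10_coef /= E !D.
- by rewrite /phi10_coef /= scaleNr E !D mul1r.
Qed.

Section Zeta10.
Variable R : realType.
Local Notation C := R[i].
Local Open Scope complex_scope.

Variable s : R.
Hypothesis s2 : s ^+ 2 = 5.
Let q := q10_of s.

Let sC2 : s%:C ^+ 2 = 5.
Proof. exact: real_complex_sqr_nat. Qed.

(** Both sides of the zeta relation are brought to the shape [bform 10 _], where [zeta10_weights]
    compares coefficients. *)
Lemma zeta10_polynomial :
  zeta_polynomial q 10 2 (bform 10 (phi10_coef s%:C))
    (Poly (zeta10_coef s%:C)).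
Proof.
split; first exact: size_Poly.
rewrite zeta_expansion_series // X0_bform bformB bformZ.
have zE j : (j <= 8)%N ->
    zeta_series q (Poly (zeta10_coef s%:C)) j = (zeta10_series s%:C)`_j.
  move=> j8; apply: etrans (zeta10_seriesP sC2 j8); rewrite /zeta_series q10_ofC.
  apply: eq_series_mull => i _; apply: eq_series_mull => l _.
  by rewrite coef_Poly.
transitivity (\sum_(k < 9) (zeta10_series s%:C)`_(8 - k) *:
   (bform 10 (fun j => (- 1) ^+ (k - (10 - j)) * 'C(k, 10 - j)%:R) *+ 'C(10, k))).
  apply: eq_bigr => k _; rewrite shifted_power_bform; last first.
    by apply: leq_trans (ltnW (ltn_ord k)) _.
  by rewrite zE // leq_subr.
rewrite (bform_lincomb 10 9 (fun k => (zeta10_series s%:C)`_(8 - k))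
  (fun k => 'C(10, k)) (fun k j => (- 1) ^+ (k - (10 - j)) * 'C(k, 10 - j)%:R)).
apply: eq_bform => j j10.
rewrite (zeta10_weights sC2 j10); congr (_^-1 * _).
by rewrite -q10_ofC rmorphB rmorph1.
Qed.

(* [u] plays the role of z + 1 / (q z), since 1 / q = (5 - s) / 8. *)
Lemma zeta10_horner (z u : C) : u * z = z ^+ 2 + (5 - s%:C) / 8 ->
  (Poly (zeta10_coef s%:C)).[z] =
  (1 - q%:C * z ^+ 2) * (- 64 / 5 - 128 / 25 * s%:C) * z ^+ 3 *
  (u ^+ 3 + (1 - s%:C) / 4 * u ^+ 2 - 5 / 4 * u - (5 - s%:C) / 16).
Proof.
move=> uz.
have -> : (1 - q%:C * z ^+ 2) * (- 64 / 5 - 128 / 25 * s%:C) * z ^+ 3 *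
  (u ^+ 3 + (1 - s%:C) / 4 * u ^+ 2 - 5 / 4 * u - (5 - s%:C) / 16) =
  (1 - q%:C * z ^+ 2) * (- 64 / 5 - 128 / 25 * s%:C) *
  ((u * z) ^+ 3 + (1 - s%:C) / 4 * (u * z) ^+ 2 * z - 5 / 4 * (u * z) * z ^+ 2
   - (5 - s%:C) / 16 * z ^+ 3) by field.
rewrite uz /q q10_ofC /q10_of horner_Poly /=.
by field: sC2.
Qed.
End Zeta10.

(** * Location of the zeros *)

Lemma sqrt5_bounds (F : realFieldType) (t : F) :
  0 < t -> t ^+ 2 = 5 -> 2236 / 1000 < t < 2237 / 1000.
Proof. by move=> t0 t2; apply/andP; split; nra. Qed.

Section ComplexNorm.
Variable R : realType.
Local Notation C := R[i].
Local Open Scope complex_scope.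

Lemma normc_sqr_inv (q : R) (z : C) : 0 < q ->
  complex.Re z ^+ 2 + complex.Im z ^+ 2 = q^-1 ->
  `|z| = ((Num.sqrt q)^-1)%:C.
Proof. by move=> q0 zq; rewrite normc_def zq sqrtrV // ltW. Qed.

(** The real quadratic T^2 - r T + m has negative discriminant, so its roots are conjugate and their
    product [m] is the squared modulus. *)
Lemma real_quadratic_norm (z : C) (r m : R) :
  z ^+ 2 + m%:C = r%:C * z -> r ^+ 2 < 4 * m ->
  complex.Re z ^+ 2 + complex.Im z ^+ 2 = m.
Proof.
case: z => a b; rewrite expr2 => /eqP; rewrite eq_complex /=.
move=> /andP[/eqP re /eqP im] rm.
have [b0|b0] := eqVneq b 0.
  have : (a - r / 2) ^+ 2 < 0 by nra.
  by rewrite ltNge sqr_ge0.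
have a_r : a = r / 2.
  by apply: (mulIf b0); lra.
by nra.
Qed.

Lemma real_square_norm (z : C) (m : R) : z ^+ 2 = m%:C -> 0 < m ->
  complex.Re z ^+ 2 + complex.Im z ^+ 2 = m.
Proof.
case: z => a b; rewrite expr2 => /eqP; rewrite eq_complex /=.
move=> /andP[/eqP re /eqP im] m0.
have /eqP : a * b = 0 by lra.
by rewrite mulf_eq0 => /orP[] /eqP x0; move: re; rewrite x0; nra.
Qed.

End ComplexNorm.

Section RiemannHypothesis.
Variable R : realType.
Local Notation C := R[i].
Local Open Scope complex_scope.

Variable s : R.
Hypothesis s2 : s ^+ 2 = 5.
Let q := q10_of s.
Hypothesis q_gt0 : 0 < q.
Let phi := bform 10 (phi10_coef s%:C).

Let sC2 : s%:C ^+ 2 = 5.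
Proof. exact: real_complex_sqr_nat. Qed.

Let qV : q^-1 = (5 - s) / 8.
Proof.
have q0 : q != 0 by rewrite gt_eqF.
by apply: (mulfI q0); rewrite mulfV // /q /q10_of; field: s2.
Qed.

Lemma zeta10_cubic_roots : s < 0 -> exists rs : seq R,
  [/\ forall r, r \in rs -> - 3 / 2 < r < 1,
      uniq rs, size rs = 3%N &
      all (root (Poly [:: - (5 - s) / 16; - 5 / 4; (1 - s) / 4; 1])) rs].
Proof.
move=> s0; set p := Poly _.
have /andP[lt_s s_lt] : 2236 / 1000 < - s < 2237 / 1000.
  by apply: sqrt5_bounds; rewrite ?sqrrN // oppr_gt0.
have pE x : p.[x] = x ^+ 3 + (1 - s) / 4 * x ^+ 2 - 5 / 4 * x - (5 - s) / 16.
  by rewrite horner_Poly /=; field.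
(* The signs alternate at -3/2, -1, 0, 1, which separates three real roots. *)
have p1 : p.[- 3 / 2] < 0 by rewrite pE; lra.
have p2 : 0 < p.[- 1] by rewrite pE; lra.
have p3 : p.[0] < 0 by rewrite pE; lra.
have p4 : 0 < p.[1] by rewrite pE; lra.
have [||r1 /itvP i1 r1p] := @poly_ivtoo _ p (- 3 / 2) (- 1).
- by lra.
- by rewrite nmulr_rlt0.
have [||r2 /itvP i2 r2p] := @poly_ivtoo _ p (- 1) 0.
- by lra.
- by rewrite pmulr_rlt0.
have [||r3 /itvP i3 r3p] := @poly_ivtoo _ p 0 1.
- by lra.
- by rewrite nmulr_rlt0.
exists [:: r1; r2; r3]; split=> //.
- have [h1 h2] : - 3 / 2 < r1 /\ r1 < - 1 by rewrite !i1.
  have [h3 h4] : - 1 < r2 /\ r2 < 0 by rewrite !i2.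
  have [h5 h6] : 0 < r3 /\ r3 < 1 by rewrite !i3.
  by move=> r; rewrite !inE => /or3P[] /eqP ->; apply/andP; split; lra.
- have h2 : r1 < - 1 by rewrite !i1.
  have [h3 h4] : - 1 < r2 /\ r2 < 0 by rewrite !i2.
  have h5 : 0 < r3 by rewrite !i3.
  rewrite /= !inE negb_or.
  by repeat (apply/andP; split) => //; apply/eqP => e; lra.
by rewrite /= r1p r2p r3p.
Qed.

Lemma phi10_riemann_hypothesis : s < 0 -> riemann_hypothesis q 10 2 phi.
Proof.
move=> s0; exists (Poly (zeta10_coef s%:C)); first exact: zeta10_polynomial.
move=> z; rewrite rootE => Pz; apply: normc_sqr_inv => //.
have z0 : z != 0.
  apply: contraTneq Pz => ->; rewrite horner_coef0 coef_Poly /=.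
  by rewrite oppr_eq0 oner_eq0.
(* This is z + 1 / (q z), as 1 / q = (5 - s) / 8; z is nonzero because P(0) = -1. *)
pose u := z + (5 - s%:C) / 8 / z.
have uz : u * z = z ^+ 2 + (5 - s%:C) / 8 by rewrite /u; field.
have mC : ((5 - s) / 8)%:C = (5 - s%:C) / 8.
  by rewrite fmorph_div rmorphB !rmorph_nat.
have /andP[lt_s s_lt] : 2236 / 1000 < - s < 2237 / 1000.
  by apply: sqrt5_bounds; rewrite ?sqrrN // oppr_gt0.
have z3 : z ^+ 3 != 0 by rewrite expf_neq0.
move: Pz; rewrite (zeta10_horner s2 uz) mulf_eq0 => /orP[|/eqP gu].
  rewrite mulf_eq0 (negPf z3) orbF mulf_eq0 => /orP[|].
    rewrite subr_eq0 => /eqP qz; apply: real_square_norm; last by rewrite invr_gt0.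
    have qC0 : q%:C != 0 by rewrite fmorph_eq0 gt_eqF.
    by apply: (mulfI qC0); rewrite -qz -rmorphM mulfV ?rmorph1 // gt_eqF.
  rewrite (_ : _ - _ = (- 64 / 5 - 128 / 25 * s)%:C).
    by rewrite fmorph_eq0 => /eqP; lra.
  by rewrite rmorphB fmorph_div rmorphM fmorph_div rmorphN !rmorph_nat.
have [rs [rs_lt rs_uniq rs_size rs_root]] := zeta10_cubic_roots s0.
set p := Poly _ in rs_root.
have pu : root (map_poly (real_complex R) p) u.
  have e1 : (- (5 - s) / 16)%:C = - (5 - s%:C) / 16.
    by rewrite fmorph_div rmorphN rmorphB !rmorph_nat.
  have e2 : (- 5 / 4)%:C = - 5 / 4 :> C by rewrite fmorph_div rmorphN !rmorph_nat.
  have e3 : ((1 - s) / 4)%:C = (1 - s%:C) / 4.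
    by rewrite fmorph_div rmorphB rmorph1 !rmorph_nat.
  rewrite map_Poly rootE horner_Poly /= e1 e2 e3 rmorph1 -[X in _ == X]gu.
  by apply/eqP; field.
have p_size : size p = 4%N.
  by rewrite (@PolyK _ 0) //= oner_eq0.
(* Otherwise [u] would be a fourth root of the cubic. *)
have /mapP[r rrs ur] : u \in map (real_complex R) rs.
  apply: contraT => u_rs.
  have p0 : map_poly (real_complex R) p != 0.
    by rewrite map_poly_eq0 -size_poly_eq0 p_size.
  have := @max_poly_roots _ _ (u :: map (real_complex R) rs) p0.
  rewrite /= pu u_rs map_inj_uniq ?rs_uniq; last exact: fmorph_inj.
  rewrite size_map_poly p_size size_map rs_size; apply=> //.
  by apply/allP => _ /mapP[x xrs ->]; rewrite fmorph_root (allP rs_root).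
(* Now z^2 - r z + 1 / q = 0 with r real, and r^2 < 9/4 < (5 - s) / 2 = 4 / q. *)
rewrite qV; apply: (@real_quadratic_norm _ z r); first by rewrite mC -uz ur.
by have /andP[h1 h2] := rs_lt _ rrs; nra.
Qed.

Lemma phi10_not_riemann_hypothesis : 0 < s -> ~ riemann_hypothesis q 10 2 phi.
Proof.
move=> s0 [P Pzeta Proots].
(* By uniqueness of the zeta polynomial, a bad zero of the explicit one suffices. *)
have PE : P = Poly (zeta10_coef s%:C).
  have [P' [_ uniqP]] := zeta_polynomial_exists_unique (q10_of_neq1 s2)
                           (phi10_weight_form s2).
  by rewrite -(uniqP _ Pzeta) (uniqP _ (zeta10_polynomial s2)).
have /andP[lt_s s_lt] := sqrt5_bounds s0 s2.
have [||x /andP[x1 x2] px] := @Num.poly_ivt R (Poly (zeta10_coef s)) (4 / 5) 1.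
- by lra.
- by rewrite !horner_Poly /=; apply/andP; split; lra.
have : root P x%:C.
  by rewrite PE -(rmorph_zeta10_coef (real_complex R)) -map_Poly fmorph_root.
move=> /Proots; rewrite normc_def /= => /complexI.
rewrite expr0n addr0 sqrtr_sqr => xq.
have : x ^+ 2 = q^-1.
  by rewrite -real_normK ?num_real // xq exprVn sqr_sqrtr // ltW.
(* Here x^2 >= 16/25, whereas (5 - s) / 8 < 2/5. *)
rewrite qV => x2q; nra.
Qed.
End RiemannHypothesis.

Theorem theorem5p7 (R : realType) :
  (extremal_fwe (q10 (1 : R)) 2 10 2 (phi10 (1 : R)) /\
   ~ riemann_hypothesis (q10 (1 : R)) 10 2 (phi10 (1 : R))) /\
  (extremal_fwe (q10 (-1 : R)) 2 10 2 (phi10 (-1 : R)) /\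
   riemann_hypothesis (q10 (-1 : R)) 10 2 (phi10 (-1 : R))).
Proof.
have r2 : Num.sqrt 5 ^+ 2 = 5 :> R by rewrite sqr_sqrtr.
have r0 : 0 < Num.sqrt 5 :> R by rewrite sqrtr_gt0.
have qE (e : R) : q10 e = q10_of (e * Num.sqrt 5) by rewrite /q10 /q10_of; field.
rewrite !phi10_bform !qE mul1r mulN1r.
have n2 : (- Num.sqrt 5) ^+ 2 = 5 :> R by rewrite sqrrN.
have q1 : 0 < q10_of (Num.sqrt 5) :> R by rewrite /q10_of; lra.
have q2 : 0 < q10_of (- Num.sqrt 5) :> R by rewrite /q10_of; nra.
split; split.
- exact: phi10_extremal.
- exact: phi10_not_riemann_hypothesis.
- exact: phi10_extremal.
- by apply: phi10_riemann_hypothesis; rewrite ?oppr_lt0.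
Qed.
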